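(* Let $E$ be a mean-payoff automaton expression built from deterministic $\mathsf{LimInfAvg}$-automata $A_1,\dots,A_n$, let $A_E=A_1\times\cdots\times A_n$ be their synchronized product, and let $\mathcal{Z}$ be the set of strongly connected components of the underlying graph of $A_E$. For $\mathcal{C}\in\mathcal{Z}$ let $S_{\mathcal{C}}$ be the set of vector values of the simple cycles in $\mathcal{C}$. Then the vector set of $E$ is $V_E=\bigcup_{\mathcal{C}\in\mathcal{Z}}F_{\min}(\mathsf{conv}(S_{\mathcal{C}}))$.
   Context: A $\mathbb{Q}$-weighted automaton is $A=\langle Q,q_I,\Sigma,\delta,\mathsf{wt}\rangle$ with finite $Q$, initial $q_I$, finite alphabet $\Sigma$, total $\delta\subseteq Q\times\Sigma\times Q$, and $\mathsf{wt}:\delta\to\mathbb{Q}$; deterministic means exactly one successor per state and letter. For a deterministic $\mathsf{LimInfAvg}$-automaton, $L_A(w)=\liminf_{n\to\infty}\frac1n\sum_{i=0}^{n-1}v_i$ where $v_0v_1\dots$ is the weight sequence of the unique run on $w$. A mean-payoff automaton expression is generated by $E::=A\mid\max(E,E)\mid\min(E,E)\mid\mathrm{sum}(E,E)$ with $A$ deterministic mean-payoff automata, interpreted pointwise. The vector set is $V_E=\{(L_{A_1}(w),\dots,L_{A_n}(w))\mid w\in\Sigma^\omega\}$ where $A_1,\dots,A_n$ are the automata occurring in $E$. The synchronized product $A_E$ has state tuples $(q_1,\dots,q_n)$, initial state the tuple of initial states, a $\sigma$-transition when each component has a $\sigma$-transition $t_i$, with weight vector $(\mathsf{wt}_1(t_1),\dots,\mathsf{wt}_n(t_n))$.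 The vector value of a cycle is the average of the weight vectors on its edges. For finite nonempty $P\subseteq\mathbb{R}^n$, $f_{\min}(P)$ is the coordinatewise minimum of $P$; $F_{\min}(S)=\{f_{\min}(P)\mid P\text{ finite nonempty subset of } S\}$. $\mathsf{conv}$ is convex hull.
   Formalization: The strongly connected components in Z are only those of the part of A_E reachable from its initial state; over all state tuples the claim fails, since an unreachable component (e.g. an isolated state with a self-loop of a different weight) would contribute values no word attains. *)

(* Defs.v *)
From HB Require Import structures.
From mathcomp Require Import all_boot all_order all_algebra.
From mathcomp Require Import all_classical all_reals all_analysis.

Set Implicit Arguments.
Unset Strict Implicit.
Unset Printing Implicit Defensive.

Import Order.TTheory GRing.Theory Num.Theory.
Import numFieldNormedType.Exports.

Local Open Scope classical_set_scope.
Local Open Scope ring_scope.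

(* The weight domain [W] is [rat] for the automata occurring in expressions and
   ['rV[rat]_n] for their synchronized product. *)
Record automaton (Sigma : finType) (W : Type) := Automaton {
  state : finType;
  init : state;
  delta : {set state * Sigma * state};
  delta_total : forall q s, exists q', (q, s, q') \in delta;
  wt : {t : state * Sigma * state | t \in delta} -> W
}.

Arguments init {Sigma W} a.
Arguments delta {Sigma W} a.
Arguments wt {Sigma W} a _.

Section Automaton.
Variables (Sigma : finType) (W : Type) (A : automaton Sigma W).

Definition transition := {t : state A * Sigma * state A | t \in delta A}.

Definition src (t : transition) : state A := (val t).1.1.
Definition dst (t : transition) : state A := (val t).2.

Definition deterministic :=
  forall q s, exists! q', (q, s, q') \in delta A.

(* The successor is obtained by choice from totality; when [A] is deterministic
   it is the only one, so [run] is the unique run of [A] on [w]. *)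
Definition step (q : state A) (s : Sigma) : transition :=
  exist _ (q, s, xchoose (delta_total q s)) (xchooseP (delta_total q s)).

Fixpoint run (w : nat -> Sigma) (i : nat) : state A :=
  if i is j.+1 then dst (step (run w j) (w j)) else init A.

Definition weights (w : nat -> Sigma) (i : nat) : W :=
  wt A (step (run w i) (w i)).

Definition edge : rel (state A) :=
  fun q q' => [exists s, (q, s, q') \in delta A].

(* Only the states reachable from the initial state are taken into account:
   a component that no run can enter contributes no value. *)
Definition reachable : {set state A} := [set q | connect edge (init A) q].

Definition sccs : {set {set state A}} :=
  equivalence_partition
    (fun q q' => connect edge q q' && connect edge q' q) reachable.

(* A cycle is a sequence of transitions, since two states may be joined by
   several transitions carrying different weights. *)
Definition simple_cycle (C : {set state A}) (c : seq transition) : bool :=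
  [&& c != [::],
      cycle (fun t t' => dst t == src t') c,
      uniq (map src c)
    & all (fun t => src t \in C) c].

End Automaton.

Section MeanPayoff.
Variables (R : realType) (Sigma : finType).

Definition LimInfAvg (A : automaton Sigma rat) (w : nat -> Sigma) : R :=
  limn_inf (fun n : nat => n%:R^-1 * \sum_(i < n) ratr (weights A w i) : R).

Inductive mpexpr :=
| Aut (A : automaton Sigma rat) (detA : deterministic A)
| Emax (E1 E2 : mpexpr)
| Emin (E1 E2 : mpexpr)
| Esum (E1 E2 : mpexpr).

Fixpoint mpexpr_value (E : mpexpr) (w : nat -> Sigma) : R :=
  match E with
  | Aut A _ => LimInfAvg A w
  | Emax E1 E2 => Num.max (mpexpr_value E1 w) (mpexpr_value E2 w)
  | Emin E1 E2 => Num.min (mpexpr_value E1 w) (mpexpr_value E2 w)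
  | Esum E1 E2 => mpexpr_value E1 w + mpexpr_value E2 w
  end.

Fixpoint occurs (B : automaton Sigma rat) (E : mpexpr) : Prop :=
  match E with
  | Aut A _ => B = A
  | Emax E1 E2 | Emin E1 E2 | Esum E1 E2 => occurs B E1 \/ occurs B E2
  end.

(* An automaton occurring several times in [E] may be listed once or several
   times, and in any order. *)
Definition built_from (E : mpexpr) (n : nat) (A : 'I_n -> automaton Sigma rat) :=
  forall B, occurs B E <-> exists i, A i = B.

Definition vector_set (n : nat) (A : 'I_n -> automaton Sigma rat) :
    set 'rV[R]_n :=
  [set \row_i LimInfAvg (A i) w | w in [set: nat -> Sigma]].

End MeanPayoff.

Section Product.
Variables (Sigma : finType) (n : nat) (A : 'I_n -> automaton Sigma rat).

Definition sync_state : finType := {dffun forall i : 'I_n, state (A i)}.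

Definition sync_init : sync_state := [ffun i => init (A i)].

Definition sync_delta : {set sync_state * Sigma * sync_state} :=
  [set t : sync_state * Sigma * sync_state |
    [forall i, ((t.1.1 : sync_state) i, t.1.2, (t.2 : sync_state) i)
                 \in delta (A i)]].

Lemma sync_total (q : sync_state) (s : Sigma) :
  exists q', (q, s, q') \in sync_delta.
Proof.
exists ([ffun i => xchoose (delta_total (q i) s)] : sync_state).
rewrite inE; apply/forallP => i /=; rewrite ffunE.
exact: (xchooseP (delta_total (q i) s)).
Qed.

Lemma sync_component_subproof
    (t : {t : sync_state * Sigma * sync_state | t \in sync_delta}) (i : 'I_n) :
  (((val t).1.1 : sync_state) i, (val t).1.2, ((val t).2 : sync_state) i)
    \in delta (A i).
Proof. by case: t => t /=; rewrite inE => /forallP /(_ i). Qed.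

Definition sync_component
    (t : {t : sync_state * Sigma * sync_state | t \in sync_delta}) (i : 'I_n) :
    transition (A i) :=
  exist (fun u => u \in delta (A i)) _ (sync_component_subproof t i).

Definition sync_product : automaton Sigma 'rV[rat]_n :=
  Automaton sync_init sync_total
    (fun t => \row_i wt (A i) (sync_component t i)).

End Product.

Section Vectors.
Variables (R : realType) (n : nat).

Definition cycle_value (Sigma : finType) (A : automaton Sigma 'rV[rat]_n)
    (c : seq (transition A)) : 'rV[rat]_n :=
  (size c)%:R^-1 *: \sum_(t <- c) wt A t.

Definition simple_cycle_values (Sigma : finType)
    (A : automaton Sigma 'rV[rat]_n) (C : {set state A}) : set 'rV[R]_n :=
  [set map_mx ratr (cycle_value c) | c in [set c | simple_cycle C c]].

Definition convex_hull (S : set 'rV[R]_n) : set 'rV[R]_n :=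
  smallest (@convex_set R 'rV[R]_n) S.

Definition is_fmin (P : set 'rV[R]_n) (v : 'rV[R]_n) :=
  forall i, (exists2 p, P p & p ord0 i = v ord0 i) /\
            (forall p, P p -> v ord0 i <= p ord0 i).

Definition F_min (S : set 'rV[R]_n) : set 'rV[R]_n :=
  [set v | exists P : set 'rV[R]_n,
     [/\ finite_set P, P !=set0, P `<=` S & is_fmin P v]].

End Vectors.

Arguments simple_cycle_values R {n Sigma A} C.
Arguments vector_set R {Sigma n} A.

(* Main.v *)
(** Both inclusions are about the deterministic product, whose run on a word is
    the tuple of the runs of the components.

    A run stays eventually in one strongly connected component.  For a coordinate
    [i], the edge frequencies of its prefixes converge, along an ultrafilter that
    refines a sequence of prefixes realizing the [i]-th limit inferior, to a
    circulation of mass 1 supported in that component.  Subtracting cycles one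
    after the other from a circulation shows that its mean weight [p_i] is a
    convex combination of values of simple cycles; the limit inferiors are the
    coordinatewise minimum of the [p_i].

    Conversely, the points approximated by mean values of closed walks at a given
    state of a component form a convex set containing the values of its simple
    cycles.  A word that repeats such walks so as to approach in turn each point
    of a finite set [P], every phase being long enough for the next closed walk
    to be negligible with respect to the prefix already read, has limit inferior
    [f_min(P)]. *)
Require Import Defs.
From HB Require Import structures.
From mathcomp Require Import all_boot all_order all_algebra.
From mathcomp Require Import all_classical all_reals all_analysis.
From mathcomp Require Import zify ring lra.

Set Implicit Arguments.
Unset Strict Implicit.
Unset Printing Implicit Defensive.

Import Order.TTheory GRing.Theory Num.Theory.
Import numFieldNormedType.Exports.

Local Open Scope classical_set_scope.
Local Open Scope ring_scope.

(** * Limit inferior of a bounded sequence *)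

(** The limit inferior is the supremum of the tail infima: some tail infimum exceeds it minus [e],
    and every tail infimum lies strictly below it plus [e]. *)
Lemma limn_inf_spec (R : realType) (u : nat -> R) : bounded_fun u ->
  forall e, 0 < e ->
    (exists N, forall m, (N <= m)%N -> limn_inf u - e <= u m) /\
    (forall N, exists2 m, (N <= m)%N & u m <= limn_inf u + e).
Proof.
move=> bu e e0; rewrite limn_infE//.
have hsup : has_sup (range (infs u)).
  by split; [exists (infs u 0), 0%N | exact: bounded_fun_has_ubound_infs].
have hlb N : has_lbound (sdrop u N).
  exact/has_lbound_sdrop/bounded_fun_has_lbound.
split.
  have [_ [N _ <-] /ltW lN] := sup_adherent e0 hsup.
  exists N => m Nm; apply: (le_trans lN).
  by apply: ge_inf => //; exists m.
move=> N.
have lt1 : infs u N < sup (range (infs u)) + e.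
  rewrite (@le_lt_trans _ _ (sup (range (infs u))))// ?ltrDl//.
  by apply: ub_le_sup; [exact: hsup.2 | exists N].
have hinf : has_inf (sdrop u N) by split; [exists (u N), N => /= | exact: hlb].
have [_ [m Nm <-] lt2] := inf_lt hinf.1 lt1.
by exists m => //; exact: ltW.
Qed.

(** The eventual lower bound of either number meets the recurrent upper bound of the other at a
    common index; [e / 2] on each side gives [e]. *)
Lemma limn_inf_eq (R : realType) (u : nat -> R) (l : R) : bounded_fun u ->
  (forall e, 0 < e ->
    (exists N, forall m, (N <= m)%N -> l - e <= u m) /\
    (forall N, exists2 m, (N <= m)%N & u m <= l + e)) ->
  limn_inf u = l.
Proof.
move=> bu hl; apply/eqP; rewrite eq_le; apply/andP; split;
  apply/ler_addgt0Pr => e e0; have e20 : 0 < e / 2 by rewrite divr_gt0.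
- have [[N hN] _] := limn_inf_spec bu e20.
  have [_ /(_ N)[m Nm um]] := hl _ e20.
  have := hN _ Nm; lra.
- have [[N hN] _] := hl _ e20.
  have [_ /(_ N)[m Nm um]] := limn_inf_spec bu e20.
  have := hN _ Nm; lra.
Qed.

(** * Simple cycles in a set of transitions without dead ends *)

Section Cycles.
Variables (Sigma : finType) (W : Type) (A : automaton Sigma W).

Lemma periodic_point (T : finType) (f : T -> T) (x : T) :
  exists i, fcycle f (orbit f (iter i f x)).
Proof.
have /trajectP[i lti ei] := looping_order f x; exists i => //.
apply/(orbitPcycle 3 0); exists (order f x - i).-1.
rewrite prednK ?subn_gt0// -iterD subnK//; exact: ltnW.
Qed.

(** [T] is meant to be the support of a circulation: a walk in it never gets stuck, so on finitely
    many states it closes up. *)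
Lemma simple_cycle_exists (T : {set transition A}) (C : {set state A}) :
  T != finset.set0 -> (forall t, t \in T -> src t \in C) ->
  (forall t, t \in T -> exists2 t', t' \in T & src t' = dst t) ->
  exists2 c, simple_cycle C c & {subset c <= T}.
Proof.
move=> /finset.set0Pn[t0 t0T] TC Tnext.
(* Cycles of a function on states visit pairwise distinct states, so we choose one
   outgoing transition in [T] per state. *)
pose g q := odflt t0 [pick t in T | src t == q].
pose QT : {set state A} := [set src t | t in T]%SET.
have gP q : q \in QT -> g q \in T /\ src (g q) = q.
  move=> /imsetP[t tT ->]; rewrite /g; case: pickP => [t' /andP[t'T /eqP]//|].
  by move=> /(_ t); rewrite tT eqxx.
pose h q := dst (g q).
have hQ q : q \in QT -> h q \in QT.
  by move=> /gP[/Tnext[t' t'T e] _]; rewrite /h -e; apply: imset_f.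
have iQ q m : q \in QT -> iter m h q \in QT.
  by move=> qQ; elim: m => //= m; exact: hQ.
have [i cyc] := periodic_point h (src t0).
set x := iter i h (src t0) in cyc.
have xQ : x \in QT by apply: iQ; apply: imset_f.
have oQ : {subset orbit h x <= QT}.
  by move=> q; rewrite -fconnect_orbit => /iter_findex <-; apply: iQ.
exists [seq g q | q <- orbit h x]; last first.
  by move=> t /mapP[q /oQ/gP[gT _] ->].
have srcE : [seq src t | t <- [seq g q | q <- orbit h x]] = orbit h x.
  rewrite -map_comp -[RHS]map_id; apply/eq_in_map => q /oQ/gP[_ /= ->//].
apply/and4P; split.
- by rewrite -size_eq0 size_map size_orbit -lt0n order_gt0.
- rewrite cycle_map; apply: (sub_in_cycle (P := mem (orbit h x))) cyc.
    by move=> q q' _ /oQ/gP[_ /= ->].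
  by apply/allP.
- by rewrite srcE orbit_uniq.
- by apply/allP => t /mapP[q /oQ/gP[gT _] ->]; apply: TC.
Qed.

End Cycles.

(** * Circulations and the convex hull of the simple cycle values *)

Lemma convex_hull_comb (R : realType) n (S : set 'rV[R]_n) x y (a : R) :
  0 <= a <= 1 -> convex_hull S x -> convex_hull S y ->
  convex_hull S (a *: x + (1 - a) *: y).
Proof.
move=> /andP[a0 a1] Sx Sy K [cK SK].
have [a' aE] : exists a' : {i01 R}, a'%:num = a.
  by exists (Itv01 a0 a1).
rewrite -aE; apply: set_mem; apply: (cK _ _ a'); apply: mem_set.
  exact: Sx.
exact: Sy.
Qed.

Lemma sum_indicator_scale (R : pzRingType) (V : lmodType R) (T : finType)
    (c : seq T) (f : T -> V) : uniq c ->
  \sum_t (t \in c)%:R *: f t = \sum_(t <- c) f t.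
Proof.
move=> uc; rewrite [RHS](big_uniq _ uc) [RHS]big_mkcond; apply: eq_bigr => t _.
by case: ifP => _; rewrite ?scale1r ?scale0r.
Qed.

Lemma sum_indicator (R : pzRingType) (T : finType) (c : seq T) (P : pred T) :
  uniq c -> \sum_(t | P t) (t \in c)%:R = (count P c)%:R :> R.
Proof.
move=> uc; rewrite -sum1_count natr_sum [RHS]big_mkcond [RHS](big_uniq _ uc).
rewrite [LHS]big_mkcond [RHS]big_mkcond/=.
by apply: eq_bigr => t _; case: (t \in c); case: (P t).
Qed.

Section Circulations.
Variables (R : realType) (Sigma : finType) (n : nat).
Variable A : automaton Sigma 'rV[rat]_n.

Definition wvec (t : transition A) : 'rV[R]_n := map_mx ratr (wt A t).

Lemma cycle_valueE (c : seq (transition A)) :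
  map_mx ratr (cycle_value c) = (size c)%:R^-1 *: \sum_(t <- c) wvec t.
Proof.
rewrite /cycle_value; apply/rowP => j; rewrite !mxE rmorphM/= fmorphV rmorph_nat.
rewrite !summxE rmorph_sum/=; congr (_ * _).
by apply: eq_bigr => t _; rewrite mxE.
Qed.

Definition circulation (mu : transition A -> R) :=
  (forall t, 0 <= mu t) /\
  forall q, \sum_(t | src t == q) mu t = \sum_(t | dst t == q) mu t.

(** Along a path the sources are the destinations delayed by one step, so the two counts differ only
    at the ends, which coincide on a cycle. *)
Lemma cycle_balance (c : seq (transition A)) q :
  cycle (fun t t' => dst t == src t') c ->
  (count (fun t => src t == q) c = count (fun t => dst t == q) c)%N.
Proof.
case: c => // t0 c /=; rewrite rcons_path => /andP[].
suff H t : path (fun t t' => dst t == src t') t c ->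
   ((dst t == q) + count (fun t => dst t == q) c =
    (dst (last t c) == q) + count (fun t => src t == q) c)%N.
  by move=> /H -> /eqP ->; rewrite addnC addnC.
elim: c t => //= t' c IH t /andP[/eqP -> /IH h].
by rewrite h addnA [in RHS]addnCA addnA.
Qed.

(** Induction on the size of the support: a suitable multiple of a simple cycle is subtracted, and
    the mean is a convex combination of the value of that cycle and the mean of what remains. *)
Lemma circulation_hull (C : {set state A}) (mu : transition A -> R) :
  circulation mu -> (forall t, mu t != 0 -> src t \in C) ->
  0 < \sum_t mu t ->
  convex_hull (simple_cycle_values R C)
    ((\sum_t mu t)^-1 *: \sum_t mu t *: wvec t).
Proof.
move: {2}(#|[set t | mu t != 0]%SET|) (leqnn #|[set t | mu t != 0]%SET|) => k.
elim: k mu => [|k IH] mu.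
  rewrite leqn0 cards_eq0 => /eqP mu0 _ _; rewrite big1 ?ltxx// => t _.
  by have := finset.in_set0 t; rewrite -mu0 inE => /negbFE/eqP.
move=> supp [mu0 bal] muC sum0.
have [t0 t0_supp] : exists t, mu t != 0.
  apply/existsP; rewrite -negb_forall; apply/negP => /forallP m0.
  by move: sum0; rewrite big1 ?ltxx// => t _; apply/eqP.
have [] := @simple_cycle_exists _ _ A [set t | mu t != 0]%SET C.
- by apply/finset.set0Pn; exists t0; rewrite inE.
- by move=> t; rewrite inE => /muC.
- move=> t; rewrite inE => mut.
  (* Conservation at [dst t]: the inflow is at least [mu t > 0], so some outgoing transition carries
     mass. *)
  have : 0 < \sum_(t' | src t' == dst t) mu t'.
    rewrite bal (bigD1 t)//= ltr_wpDr ?sumr_ge0//.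
    by rewrite lt_neqAle eq_sym mut mu0.
  case: (pickP (fun t' => (src t' == dst t) && (mu t' != 0))) =>
    [t' /andP[/eqP e m] _|no].
    by exists t'; rewrite ?inE.
  rewrite big1 ?ltxx// => t' e; have := no t'; rewrite e /= => /negbFE/eqP//.
move=> c simp csub.
have [cnil cyc cuniq _] := and4P simp.
have uc : uniq c := map_uniq cuniq.
(* The minimum of [mu] on the cycle is the largest multiple that keeps [mu'] nonnegative; it cancels
   [mu'] at [t1], so the support shrinks. *)
have [t1 t1c mint] : exists2 t1, t1 \in c & forall t, t \in c -> mu t1 <= mu t.
  case: c cnil {simp csub cyc cuniq uc} => // t1 c _.
  exists [arg min_(t < t1 | t \in t1 :: c) mu t]%O.
    by case: arg_minP => //; rewrite inE eqxx.
  by case: arg_minP => //; rewrite inE eqxx.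
set m := mu t1 in mint.
have m0 : 0 < m by rewrite lt_neqAle mu0 eq_sym andbT; have := csub _ t1c; rewrite inE.
have vc : convex_hull (simple_cycle_values R C)
    ((size c)%:R^-1 *: \sum_(t <- c) wvec t).
  by apply: sub_gen_smallest; exists c => //; exact: cycle_valueE.
pose mu' t := mu t - m * (t \in c)%:R.
have sumc (f : transition A -> 'rV[R]_n) := sum_indicator_scale f uc.
have sumc1 P : _ = _ :> R := sum_indicator R P uc.
have sumE : \sum_t mu' t = \sum_t mu t - m * (size c)%:R.
  by rewrite sumrB -mulr_sumr sumc1 count_predT.
have sumV : \sum_t mu' t *: wvec t = \sum_t mu t *: wvec t - m *: \sum_(t <- c) wvec t.
  rewrite -sumc scaler_sumr -sumrB; apply: eq_bigr => t _.
  by rewrite scalerBl scalerA.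
have mu'0 t : 0 <= mu' t.
  rewrite /mu'; case: (boolP (t \in c)) => [/mint|_]; rewrite ?mulr1 ?mulr0 ?subr0//.
  by rewrite subr_ge0.
have circ' : circulation mu'.
  split=> // q; rewrite !sumrB bal; congr (_ - _).
  by rewrite -!mulr_sumr !sumc1 (cycle_balance q cyc).
have supp' t : mu' t != 0 -> mu t != 0.
  apply: contraNneq => mut; rewrite /mu'; case: (boolP (t \in c)); last first.
    by rewrite mulr0 subr0 mut.
  by move/csub; rewrite inE mut eqxx.
have szc : 0 < (size c)%:R :> R by rewrite ltr0n lt0n size_eq0.
(* If no mass remains, [mu] is [m] times the cycle and its mean is the value of the cycle. *)
have [s0|s0] := eqVneq (\sum_t mu' t) 0.
  have z t : mu' t = 0.
    exact: (psumr_eq0P (fun i _ => mu'0 i) s0).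
  have v0 : \sum_t mu' t *: wvec t = 0 by rewrite big1// => t _; rewrite z scale0r.
  move: sumE sumV; rewrite s0 v0 => /esym/eqP; rewrite subr_eq0 => /eqP -> /esym/eqP; rewrite subr_eq0 => /eqP ->.
  by rewrite scalerA invfM mulrAC mulVf ?mul1r ?gt_eqF.
have s1 : 0 < \sum_t mu' t by rewrite lt_neqAle eq_sym s0 sumr_ge0.
have IHc : convex_hull (simple_cycle_values R C)
    ((\sum_t mu' t)^-1 *: \sum_t mu' t *: wvec t).
  apply: IH => //.
    rewrite -ltnS; apply: leq_trans supp; apply: proper_card.
    apply/properP; split.
      by apply/fintype.subsetP => t; rewrite !inE; exact: supp'.
    exists t1; first by have := csub _ t1c.
    by rewrite inE /mu' t1c mulr1 subrr eqxx.
  by move=> t /supp'/muC.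
(* The coefficient is the fraction of the mass that survives the subtraction. *)
pose a := (\sum_t mu' t) / (\sum_t mu t).
have -> : (\sum_t mu t)^-1 *: (\sum_t mu t *: wvec t) =
   a *: ((\sum_t mu' t)^-1 *: (\sum_t mu' t *: wvec t)) +
   (1 - a) *: ((size c)%:R^-1 *: \sum_(t <- c) wvec t).
  rewrite !scalerA sumV /a sumE; move: (\sum_t _ *: _) (\sum_(t <- c) _) => X Y.
  apply/rowP => j; rewrite !mxE.
  by rewrite sumE in s0; field; rewrite s0 !gt_eqF.
apply: convex_hull_comb => //.
rewrite divr_ge0 ?(ltW s1) ?(ltW sum0)//= ler_pdivrMr// mul1r sumE.
by rewrite gerBl mulr_ge0// ltW.
Qed.

End Circulations.

(** * Limits along an ultrafilter *)

Section UltraLimit.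
Variables (R : realType) (U : set_system nat).
Hypothesis UU : UltraFilter U.

(** Compactness gives a cluster point, and a cluster point of an ultrafilter is a limit, since each
    set or its complement belongs to it. *)
Lemma ultra_bounded_cvg (u : nat -> R) (M : R) :
  (forall k, `|u k| <= M) -> exists l : R, u @ U --> l.
Proof.
move=> uM.
have UM : (u @ U) [set` `[- M, M]].
  by apply: (@filterE _ U) => k /=; rewrite in_itv/= -ler_norml.
have [l [_ lU]] := @segment_compact R (- M) M _ _ UM.
exists l => V Vl.
have [//|nV] := in_ultra_setVsetC (u @^-1` V) UU.
have [x [nVx Vx]] := lU (~` V) V nV Vl.
by case: (nVx Vx).
Qed.

Hypothesis Uoo : \oo `<=` U.

Lemma ultra_cvg_le (u v : nat -> R) (a b : R) :
  u @ U --> a -> v @ \oo --> b -> (\forall k \near \oo, u k <= v k) -> a <= b.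
Proof.
move=> ua vb uv; have vU : v @ U --> b by move=> V /vb; exact: Uoo.
by apply: (ler_cvg_to ua vU); exact: Uoo.
Qed.

Lemma cvg_sumr (F : set_system nat) (FF : Filter F) (I : Type) (r : seq I)
    (P : pred I) (u : I -> nat -> R) (a : I -> R) :
  (forall i, P i -> u i @ F --> a i) ->
  (fun k => \sum_(i <- r | P i) u i k) @ F --> \sum_(i <- r | P i) a i.
Proof. by apply: cvg_big; exact: add_continuous. Qed.

End UltraLimit.

(** * Transition frequencies along a run and their limits *)

Section Frequencies.
Variables (R : realType) (Sigma : finType) (n : nat).
Variables (A : automaton Sigma 'rV[rat]_n) (w : nat -> Sigma).

Definition trans j : transition A := step (run A w j) (w j).

Definition avg (i : 'I_n) (N : nat) : R :=
  N%:R^-1 * \sum_(j < N) ratr (weights A w j ord0 i).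

Definition freq (N : nat) (t : transition A) : R :=
  N%:R^-1 * \sum_(j < N) (trans j == t)%:R.

Lemma freq_ge0 N t : 0 <= freq N t.
Proof. by rewrite mulr_ge0 ?invr_ge0 ?sumr_ge0. Qed.

Lemma sum_freq_pred (P : pred (transition A)) N :
  \sum_(t | P t) freq N t = N%:R^-1 * \sum_(j < N) (P (trans j))%:R.
Proof.
rewrite -mulr_sumr exchange_big/=; congr (_ * _); apply: eq_bigr => j _.
rewrite big_mkcond (bigD1 (trans j))//= eqxx big1 ?addr0; first by case: (P _).
by move=> t; rewrite eq_sym => /negbTE ->; case: (P t).
Qed.

Lemma sum_freq N : (0 < N)%N -> \sum_t freq N t = 1.
Proof.
move=> N0; rewrite sum_freq_pred sumr_const card_ord mulVf//.
by rewrite pnatr_eq0 -lt0n.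
Qed.

Lemma freq_le1 N t : freq N t <= 1.
Proof.
have [->|N0] := posnP N; first by rewrite /freq big_ord0 mulr0.
by rewrite -(sum_freq N0) (bigD1 t)//= lerDl sumr_ge0// => t' _; exact: freq_ge0.
Qed.

Lemma avg_freq i N : avg i N = \sum_t freq N t * wvec R t ord0 i.
Proof.
rewrite /avg /freq; under [RHS]eq_bigr do rewrite -mulrA mulr_suml.
rewrite -mulr_sumr exchange_big/=; congr (_ * _); apply: eq_bigr => j _.
rewrite (bigD1 (trans j))//= eqxx mul1r big1 ?addr0; first by rewrite mxE.
by move=> t; rewrite eq_sym => /negbTE ->; rewrite mul0r.
Qed.

Lemma avg_bounded i : exists M, forall N, `|avg i N| <= M.
Proof.
exists (\sum_(t : transition A) `|wvec R t ord0 i|) => N; rewrite avg_freq.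
apply: (le_trans (ler_norm_sum _ _ _)); apply: ler_sum => t _.
by rewrite normrM ger0_norm ?freq_ge0// ler_piMl// freq_le1.
Qed.

Lemma avg_bounded_fun i : bounded_fun (avg i).
Proof.
have [M hM] := avg_bounded i.
by exists M; split => [|K MK x _ /=]; [exact: num_real | exact: le_trans (hM x) (ltW MK)].
Qed.

(** The [j]-th transition goes from [run A w j] to [run A w j.+1], so the difference telescopes to
    the first and last states. *)
Lemma freq_balance q N :
  `|\sum_(t | src t == q) freq N t - \sum_(t | dst t == q) freq N t|
     <= N%:R^-1.
Proof.
rewrite !sum_freq_pred -mulrBr -sumrB/=.
under eq_bigr => j _ do
  rewrite [src _]/(run A w j) [dst _]/(run A w j.+1) -opprB.
rewrite sumrN -(big_mkord xpredT
  (fun j => (run A w j.+1 == q)%:R - (run A w j == q)%:R)) telescope_sumr//.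
rewrite normrM normrN ger0_norm ?invr_ge0// -[leRHS]mulr1 ler_wpM2l ?invr_ge0//.
by case: (_ == q); case: (_ == q); rewrite ?subrr ?subr0 ?sub0r ?normrN ?normr0 ?normr1.
Qed.

Lemma visited_infinitely_often :
  exists q, forall N, exists2 j, (N <= j)%N & run A w j = q.
Proof.
apply: contrapT => /forallNP h.
have /choice[N hN] : forall q, exists N, forall j, (N <= j)%N -> run A w j <> q.
  move=> q; have /existsNP[N hN] := h q; exists N => j Nj e.
  by apply: hN; exists j.
by apply: (hN (run A w (\max_q N q)) (\max_q N q)%N) => //; apply: leq_bigmax.
Qed.

Lemma run_edge j : edge (run A w j) (run A w j.+1).
Proof.
apply/existsP; exists (w j); exact: (valP (trans j)).
Qed.

Lemma run_connect j k : (j <= k)%N -> connect (@edge _ _ A) (run A w j) (run A w k).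
Proof.
elim: k => [|k IH]; first by rewrite leqn0 => /eqP ->.
rewrite leq_eqVlt => /predU1P[->//|/IH h].
exact: (connect_trans h (connect1 (run_edge k))).
Qed.

(** The component is that of a state [q] visited infinitely often: after a first visit every state
    of the run is reachable from [q] and leads back to it. *)
Lemma run_eventually_scc :
  exists2 C, C \in sccs A & exists j0, forall j, (j0 <= j)%N -> run A w j \in C.
Proof.
have [q hq] := visited_infinitely_often.
have [j0 _ ej0] := hq 0%N.
have qr : q \in reachable A by rewrite inE -ej0; exact: (run_connect (leq0n j0)).
exists [set q' in reachable A | connect (@edge _ _ A) q q' && connect (@edge _ _ A) q' q]%SET.
  by apply/imsetP; exists q.
exists j0 => j j0j; rewrite !inE (run_connect (leq0n j))/=.
rewrite -{1}ej0 run_connect//=.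
by have [k jk <-] := hq j; exact: run_connect.
Qed.

(** The point [p] is the mean weight of a limit of frequencies along prefixes that realize the limit
    inferior of coordinate [i]. *)
Lemma limit_point (C : {set state A}) (j0 : nat) (i : 'I_n) :
  (forall j, (j0 <= j)%N -> run A w j \in C) ->
  exists p, [/\ convex_hull (simple_cycle_values R C) p,
    p ord0 i = limn_inf (avg i) & forall j, limn_inf (avg j) <= p ord0 j].
Proof.
move=> hC.
have har0 k : 0 < harmonic k :> R by rewrite invr_gt0 ltr0n.
(* The bound [k.+1 <= phi k] makes the prefixes nonempty and gives [1 / phi k <= harmonic k], so
   every error below is compared with [harmonic]. *)
have /choice[phi hphi] : forall k, exists m, (k.+1 <= m)%N /\
    avg i m <= limn_inf (avg i) + harmonic k.
  move=> k; have [_ /(_ k.+1)[m km hm]] :=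
    limn_inf_spec (avg_bounded_fun i) (har0 k).
  by exists m.
have phi_har k : (phi k)%:R^-1 <= harmonic k :> R.
  have [kphi _] := hphi k.
  by rewrite /harmonic lef_pV2 ?posrE ?ltr0n ?ler_nat// (leq_trans _ kphi).
(* One ultrafilter makes all frequencies converge at once, without successive extractions of
   subsequences. *)
have [U [UU Uoo]] := ultraFilterLemma eventually_filter.
have /choice[mu hmu] t : exists l : R, (fun k => freq (phi k) t) @ U --> l.
  apply: (ultra_bounded_cvg UU (M := 1)) => k.
  by rewrite ger0_norm ?freq_ge0// freq_le1.
have mu_sum (P : pred (transition A)) :
    (fun k => \sum_(t | P t) freq (phi k) t) @ U --> \sum_(t | P t) mu t.
  by apply: cvg_sumr => t _; exact: hmu.
have mu_avg j : (fun k => avg j (phi k)) @ U --> (\sum_t mu t *: wvec R t) ord0 j.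
  under eq_fun do rewrite avg_freq.
  rewrite summxE; under eq_bigr do rewrite mxE.
  by apply: cvg_sumr => t _; apply: cvgMr_tmp; exact: hmu.
have ge0 t : 0 <= mu t.
  by apply: (cvgr_to_ge (hmu t)); apply: nearW => k; exact: freq_ge0.
have sum1 : \sum_t mu t = 1.
  have e k : \sum_t freq (phi k) t = 1.
    by apply: sum_freq; apply: leq_trans (hphi k).1.
  apply/eqP; rewrite eq_le (cvgr_to_le (mu_sum xpredT))/=.
    by apply: (cvgr_to_ge (mu_sum xpredT)); apply: nearW => k; rewrite e.
  by apply: nearW => k; rewrite e.
have bal q : \sum_(t | src t == q) mu t = \sum_(t | dst t == q) mu t.
  have hb k := le_trans (freq_balance q (phi k)) (phi_har k).
  apply/eqP; rewrite eq_le -subr_le0 -[X in _ && X]subr_le0.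
  apply/andP; split.
    apply: (ultra_cvg_le UU Uoo (cvgB (mu_sum _) (mu_sum _)) cvg_harmonic).
    by apply: nearW => k; apply: le_trans (hb k); exact: ler_norm.
  apply: (ultra_cvg_le UU Uoo (cvgB (mu_sum _) (mu_sum _)) cvg_harmonic).
  by apply: nearW => k; apply: le_trans (hb k); rewrite distrC ler_norm.
have supp t : mu t != 0 -> src t \in C.
  apply: contraNT => tC; rewrite eq_le ge0 andbT.
  (* A transition leaving a state outside [C] is taken only before time [j0], so its frequency is at
     most [j0 / phi k], which tends to 0. *)
  have cnt N : (\sum_(j < N) (trans j == t) <= minn N j0)%N.
    elim: N => [|N IH]; first by rewrite big_ord0.
    rewrite big_ord_recr/=; case: eqP => [e|_]; last by rewrite addn0 (leq_trans IH)//; lia.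
    have : ~~ (j0 <= N)%N by apply: contra tC => /hC; rewrite -e.
    by move=> Nj0; rewrite (leq_trans (leq_add IH (leqnn 1%N)))//; lia.
  have : (fun k => j0%:R * harmonic k) @ \oo --> (j0%:R * 0 : R).
    by apply: cvgMl_tmp; exact: cvg_harmonic.
  rewrite mulr0 => h; apply: (ultra_cvg_le UU Uoo (hmu t) h).
  apply: nearW => k; rewrite /freq -natr_sum mulrC.
  by rewrite ler_pM// ler_nat (leq_trans (cnt _))// geq_minr.
have lower j : limn_inf (avg j) <= (\sum_t mu t *: wvec R t) ord0 j.
  apply/ler_addgt0Pr => e e0; rewrite -lerBlDr.
  have [[N hN] _] := limn_inf_spec (avg_bounded_fun j) e0.
  apply: (cvgr_to_ge (mu_avg j)); apply: Uoo.
  by exists N => // k /= Nk; apply: hN; have [kphi _] := hphi k; lia.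
exists (\sum_t mu t *: wvec R t); split => //.
  have := circulation_hull (conj ge0 bal) supp.
  by rewrite sum1 invr1 scale1r; apply; exact: ltr01.
(* In coordinate [i] the choice of [phi] supplies the reverse inequality. *)
apply/eqP; rewrite eq_le lower andbT.
have : (fun k => limn_inf (avg i) + harmonic k) @ \oo --> limn_inf (avg i) + 0.
  by apply: cvgD; [exact: cvg_cst | exact: cvg_harmonic].
rewrite addr0 => h; apply: (ultra_cvg_le UU Uoo (mu_avg i) h).
by apply: nearW => k; have [] := hphi k.
Qed.

End Frequencies.

(** * Finite words and the paths they drive *)

Section Words.
Variables (Sigma : finType) (W : Type) (A : automaton Sigma W).

Definition goto (q : state A) (x : seq Sigma) : state A :=
  foldl (fun q s => dst (step q s)) q x.

Definition power (x : seq Sigma) (k : nat) : seq Sigma := flatten (nseq k x).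

Lemma goto_cat q x y : goto q (x ++ y) = goto (goto q x) y.
Proof. exact: foldl_cat. Qed.

Lemma goto_power q x k : goto q x = q -> goto q (power x k) = q.
Proof. by move=> xq; elim: k => //= k IH; rewrite /power/= goto_cat xq. Qed.

Lemma size_power x k : size (power x k) = (k * size x)%N.
Proof. by rewrite size_flatten /shape map_nseq sumn_nseq mulnC. Qed.

Lemma take_power x k N :
  exists m y, take N (power x k) = power x m ++ y /\
    exists r, y = take r x.
Proof.
elim: k N => [|k IH] N; first by exists 0%N, [::]; split => //; exists 0%N; rewrite take0.
rewrite /power/= take_cat; case: ltnP => [Nx|xN].
  by exists 0%N, (take N x); split => //; exists N.
have [m [y [-> hy]]] := IH (N - size x)%N.
by exists m.+1, y; rewrite /power/= catA.
Qed.

Lemma run_goto w N : run A w N = goto (init A) (mkseq w N).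
Proof.
by elim: N => // N IH; rewrite mkseqS -cats1 goto_cat -IH.
Qed.

Hypothesis detA : deterministic A.

Lemma dst_step q s q' : (q, s, q') \in delta A -> dst (step q s) = q'.
Proof.
move=> h; have [r [_ hr]] := detA q s.
by rewrite -(hr _ h) -(hr (dst (step q s)) (valP (step q s))).
Qed.

Lemma connect_word q q' : connect (@edge _ _ A) q q' -> exists x, goto q x = q'.
Proof.
move=> /connectP[p pp ->]; elim: p q pp => [|r p IH] q /=; first by exists [::].
move=> /andP[/existsP[s /dst_step qs] /IH[x <-]].
by exists (s :: x); rewrite /= qs.
Qed.

(** By determinism every transition is the one selected by [step], so a path of transitions can be
    replayed by reading its letters. *)
Lemma step_src (t : transition A) : step (src t) (val t).1.2 = t.
Proof.
apply: val_inj => /=; case: t => [[[q s] q'] h]; rewrite /src/=; congr (_, _, _).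
exact: (dst_step h).
Qed.

End Words.

(** * Accumulated weights and values approximated by closed walks *)

Section Costs.
Variables (R : realType) (Sigma : finType) (n : nat).
Variable (A : automaton Sigma 'rV[rat]_n).
Implicit Types (q : state A) (x : seq Sigma) (p : 'rV[R]_n) (i : 'I_n).

Fixpoint cost i q x : R :=
  if x is s :: x' then
    wvec R (step q s) ord0 i + cost i (dst (step q s)) x'
  else 0.

(* Deviation from the mean value [p], not divided by the length of [x] so that it
   is additive under concatenation. *)
Definition dev p i q x : R := cost i q x - (size x)%:R * p ord0 i.

Lemma cost_cat i q x y : cost i q (x ++ y) = cost i q x + cost i (goto q x) y.
Proof. by elim: x q => [|s x IH] q; rewrite /= ?add0r// IH addrA. Qed.

Lemma dev_cat p i q x y : dev p i q (x ++ y) = dev p i q x + dev p i (goto q x) y.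
Proof. by rewrite /dev cost_cat size_cat natrD; ring. Qed.

Lemma cost_power i q x k : goto q x = q -> cost i q (power x k) = k%:R * cost i q x.
Proof.
move=> xq; elim: k => [|k IH]; first by rewrite mul0r.
by rewrite /power/= cost_cat xq -/(power x k) IH -nat1r; ring.
Qed.

Lemma dev_power p i q x k : goto q x = q -> dev p i q (power x k) = k%:R * dev p i q x.
Proof. by move=> xq; rewrite /dev cost_power// size_power natrM; ring. Qed.

Lemma cost_bound : exists2 M, 0 <= M & forall i q x, `|cost i q x| <= M * (size x)%:R.
Proof.
pose M : R := \sum_(t : transition A) \sum_i `|wvec R t ord0 i|.
exists M; first by rewrite !sumr_ge0// => t _; rewrite sumr_ge0.
move=> i q x; elim: x q => [|s x IH] q /=; first by rewrite normr0 mulr0.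
rewrite (le_trans (ler_normD _ _))// -nat1r mulrDr mulr1 lerD//.
rewrite /M (bigD1 (step q s))//= (bigD1 i)//= -addrA lerDl addr_ge0//.
  by rewrite sumr_ge0.
by rewrite sumr_ge0// => t _; rewrite sumr_ge0.
Qed.

Lemma sum_weights_cost w i N :
  \sum_(j < N) ratr (weights A w j ord0 i) = cost i (init A) (mkseq w N) :> R.
Proof.
elim: N => [|N IH]; first by rewrite big_ord0.
by rewrite big_ord_recr IH mkseqS -cats1 cost_cat -run_goto /= addr0 mxE.
Qed.

(** Approximation is built in because closed walks have rational mean values, whereas points of the
    hull may be irrational. *)
Definition walk_value q p := forall e, 0 < e ->
  exists x, [/\ (0 < size x)%N, goto q x = q &
    forall i, `|dev p i q x| <= e * (size x)%:R].

(** Closed walks [X] and [Y] at the same state are repeated in proportions close to [l] and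
    [1 - l]. *)
Lemma walk_value_convex q : convex_set (walk_value q).
Proof.
move=> x y la /set_mem xT /set_mem yT; apply/mem_set => e e0.
have e20 : 0 < e / 2 by rewrite divr_gt0.
have [X [X0 Xq hX]] := xT _ e20.
have [Y [Y0 Yq hY]] := yT _ e20.
have l0 : 0 <= la%:num :> R by [].
have l1 : la%:num <= 1 :> R by [].
set l : R := la%:num in l0 l1.
pose K : R := \sum_i `|x ord0 i - y ord0 i|.
have KP i : `|x ord0 i - y ord0 i| <= K.
  by rewrite /K (bigD1 i)//= lerDl sumr_ge0.
have K0 : 0 <= K by rewrite sumr_ge0.
(* Rounding [N * l] to an integer [m] shifts the mean by at most [K / N]; this [N] keeps it below
   [e / 2]. *)
have [N N0 hN] : exists2 N, (0 < N)%N & K <= e / 2 * N%:R.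
  exists (Num.truncn (K / (e / 2))).+1 => //.
  by rewrite mulrC -ler_pdivrMr// ltW// truncnS_gt.
have [m mN] : exists2 m, (m <= N)%N & `|m%:R - N%:R * l| <= 1.
  have lN : 0 <= N%:R * l by rewrite mulr_ge0.
  have /andP[t1 t2] := truncn_itv lN.
  exists (Num.truncn (N%:R * l)).
    by rewrite -(ler_nat R) (le_trans t1)// ler_piMr.
  rewrite -nat1r in t2; rewrite ler_norml; lra.
move=> hm.
(* Multiplying by the length of the other word gives the two blocks lengths in the exact ratio [m]
   to [N - m]. *)
exists (power X (m * size Y) ++ power Y ((N - m) * size X)); split.
- rewrite size_cat !size_power.
  have : (0 < N * (size X * size Y))%N by rewrite !muln_gt0 N0 X0.
  nia.
- by rewrite goto_cat !goto_power.
move=> i; rewrite dev_cat goto_power// !dev_power//.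
have sz : size (power X (m * size Y) ++ power Y ((N - m) * size X)) =
    (N * (size X * size Y))%N.
  rewrite size_cat !size_power; nia.
rewrite sz !natrM natrB//; move: (hX i) (hY i).
set dx := dev x i q X; set dy := dev y i q Y.
set a := (size X)%:R; set b := (size Y)%:R.
move=> hx hy.
have a0 : 0 <= a by []. have b0 : 0 <= b by [].
set z := (X in dev X).
have ez : z ord0 i = l * x ord0 i + (1 - l) * y ord0 i by rewrite !mxE.
have -> : dev z i q X = dx + a * (x ord0 i - z ord0 i) by rewrite /dx /dev; ring.
have -> : dev z i q Y = dy + b * (y ord0 i - z ord0 i) by rewrite /dy /dev; ring.
rewrite ez.
have -> : m%:R * b * (dx + a * (x ord0 i - (l * x ord0 i + (1 - l) * y ord0 i))) +
   (N%:R - m%:R) * a * (dy + b * (y ord0 i - (l * x ord0 i + (1 - l) * y ord0 i)))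
   = m%:R * b * dx + (N%:R - m%:R) * a * dy +
     a * b * ((m%:R - N%:R * l) * (x ord0 i - y ord0 i)) by ring.
have Nm : 0 <= N%:R - m%:R :> R by rewrite subr_ge0 ler_nat.
have h1 : `|m%:R * b * dx| <= m%:R * b * (e / 2 * a).
  by rewrite normrM ger0_norm ?mulr_ge0// ler_wpM2l ?mulr_ge0.
have h2 : `|(N%:R - m%:R) * a * dy| <= (N%:R - m%:R) * a * (e / 2 * b).
  by rewrite normrM ger0_norm ?mulr_ge0// ler_wpM2l ?mulr_ge0.
have h3 : `|a * b * ((m%:R - N%:R * l) * (x ord0 i - y ord0 i))| <= a * b * (e / 2 * N%:R).
  rewrite normrM ger0_norm ?mulr_ge0// ler_wpM2l ?mulr_ge0// normrM.
  by rewrite -[leRHS]mul1r ler_pM// (le_trans (KP i)).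
apply: (le_trans (ler_normD _ _)); apply: (le_trans (lerD (ler_normD _ _) h3)).
apply: (le_trans (lerD (lerD h1 h2) (lexx _))).
by rewrite le_eqVlt; apply/orP; left; apply/eqP; field.
Qed.

End Costs.

(** * Closed walks inside a strongly connected component *)

Section Realization.
Variables (R : realType) (Sigma : finType) (n : nat).
Variable (A : automaton Sigma 'rV[rat]_n).
Hypothesis detA : deterministic A.
Implicit Types (q : state A) (x : seq Sigma) (p : 'rV[R]_n) (i : 'I_n).

Lemma sccP (C : {set state A}) : C \in sccs A ->
  {subset C <= reachable A} /\ {in C &, forall q q', connect (@edge _ _ A) q q'}.
Proof.
move=> /imsetP[q0 _ ->]; split.
  by move=> q; rewrite inE => /andP[].
move=> q q'; rewrite !inE => /and3P[_ _ qq0] /and3P[_ q0q' _].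
exact: connect_trans qq0 q0q'.
Qed.

Lemma scc_nonempty (C : {set state A}) : C \in sccs A -> exists q, q \in C.
Proof.
move=> /imsetP[q0 qr ->]; exists q0; rewrite !inE in qr *.
by rewrite qr connect0.
Qed.

Lemma cycle_word (c : seq (transition A)) (t : transition A) :
  path (fun t t' => dst t == src t') t c ->
  let x := [seq (val t').1.2 | t' <- t :: c] in
  goto (src t) x = dst (last t c) /\
  forall i, cost R i (src t) x = \sum_(t' <- t :: c) wvec R t' ord0 i.
Proof.
have gS q s x : goto q (s :: x) = goto (dst (step q s)) x by [].
have cS i q s x : cost R i q (s :: x) =
  wvec R (step q s) ord0 i + cost R i (dst (step q s)) x by [].
elim: c t => [|t' c IH] t.
  by move=> _ x; rewrite gS step_src//; split => // i; rewrite cS step_src// big_seq1 addr0.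
move=> /andP[/eqP e /IH[g h]] x; split.
  by rewrite /x map_cons gS step_src// e g.
by move=> i; rewrite big_cons -h /x map_cons cS step_src// e.
Qed.

(** Go from [q] to the cycle, turn around it many times and come back: only the two connecting words
    deviate from [p]. *)
Lemma walk_value_simple_cycle (C : {set state A}) q p :
  C \in sccs A -> q \in C -> simple_cycle_values R C p -> walk_value q p.
Proof.
move=> /sccP[_ conn] qC [c /= /and4P[+ + _ +]].
case: c => // t c _; rewrite cycle_valueE => cyc /andP[tC _] <- e e0.
have [a qa] := connect_word detA (conn _ _ qC tC).
have [b tb] := connect_word detA (conn _ _ tC qC).
move: cyc; rewrite /= rcons_path => /andP[/cycle_word[gx cx] /eqP lst].
set x := [seq _ | _ <- _] in gx cx; rewrite lst in gx.
set P := (_ *: _).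
have dx i : dev P i (src t) x = 0.
  rewrite /dev cx size_map /P mxE summxE mulrA divff ?mul1r ?subrr//.
  by rewrite pnatr_eq0.
(* [D] bounds the deviation of the connecting words in every coordinate and does not depend on the
   number [k] of turns. *)
pose D : R := \sum_i `|dev P i q a + dev P i (src t) b|.
have [k k0 hk] : exists2 k, (0 < k)%N & D / e <= k%:R.
  by exists (Num.truncn (D / e)).+1; last exact: ltW (truncnS_gt _).
exists (a ++ power x k ++ b); split.
- by rewrite !size_cat size_power !addn_gt0 muln_gt0 k0 /x size_map /= orbT.
- by rewrite goto_cat qa goto_cat goto_power.
move=> i; rewrite dev_cat qa dev_cat goto_power// dev_power// dx mulr0 add0r.
apply: (@le_trans _ _ D).
  by rewrite /D (bigD1 i)//= lerDl sumr_ge0.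
rewrite mulrC -ler_pdivrMr//; apply: (le_trans hk).
rewrite ler_nat !size_cat size_power.
have : (k <= k * size x)%N by rewrite leq_pmulr ?size_map.
lia.
Qed.

Lemma convex_hull_walk_value (C : {set state A}) q p :
  C \in sccs A -> q \in C -> convex_hull (simple_cycle_values R C) p ->
  walk_value q p.
Proof.
move=> CA qC; apply; split; first exact: walk_value_convex.
by move=> v; exact: walk_value_simple_cycle.
Qed.

(* [L] makes [u] so long that an unfinished repetition of the closed walk cannot
   lower the mean by more than [e]. *)
Lemma extend_word q p e : walk_value q p -> 0 < e ->
  exists L, forall u, goto (init A) u = q -> (L <= size u)%N -> forall K,
  exists z, [/\ goto (init A) (u ++ z) = q, (K <= size (u ++ z))%N,
    forall i, `|dev p i (init A) (u ++ z)| <= e * (size (u ++ z))%:R &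
    forall N i a, (size u <= N <= size (u ++ z))%N -> a <= p ord0 i ->
      a * (size u)%:R <= cost R i (init A) u ->
      (a - e) * N%:R <= cost R i (init A) (take N (u ++ z))].
Proof.
move=> qp e0; have e20 : 0 < e / 2 by rewrite divr_gt0.
have [x [x0 xq hx]] := qp _ e20.
have [M M0 hM] := cost_bound R A.
pose B := \sum_i `|p ord0 i|.
have pB i : `|p ord0 i| <= B by rewrite /B (bigD1 i)//= lerDl sumr_ge0.
(* An unfinished copy of [x] falls short of the mean [a] by at most [(M + B) * size x]; this length
   keeps that below [e * size u]. *)
pose L := (Num.truncn ((M + B) * (size x)%:R / e)).+1.
exists L => u uq Lu K.
pose D := \sum_i `|dev p i (init A) u|.
have DP i : `|dev p i (init A) u| <= D by rewrite /D (bigD1 i)//= lerDl sumr_ge0.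
(* Enough copies make the deviation [D] of [u] cost only [e / 2] on average; the other half pays for
   the deviation of [x] itself. *)
have [k Kk kD] : exists2 k, (K <= k)%N & D / (e / 2) <= k%:R.
  exists (K + (Num.truncn (D / (e / 2))).+1)%N; first exact: leq_addr.
  by rewrite natrD (le_trans (ltW (truncnS_gt _)))// lerDr.
have k_le : (k <= k * size x)%N by rewrite leq_pmulr.
exists (power x k); split.
- by rewrite goto_cat uq goto_power.
- by rewrite size_cat size_power; lia.
- move=> i; rewrite dev_cat uq dev_power// size_cat size_power natrD natrM.
  apply: (le_trans (ler_normD _ _)).
  have h1 : D <= e / 2 * (k%:R * (size x)%:R).
    by rewrite -natrM mulrC -ler_pdivrMr// (le_trans kD)// ler_nat.
  have h2 : `|k%:R * dev p i q x| <= k%:R * (e / 2 * (size x)%:R).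
    by rewrite normrM normr_nat ler_wpM2l.
  apply: (le_trans (lerD (le_trans (DP i) h1) h2)).
  have u0 : 0 <= e * (size u)%:R :> R by rewrite mulr_ge0// ltW.
  rewrite mulrDr -subr_ge0; apply: (le_trans u0).
  by rewrite le_eqVlt; apply/orP; left; apply/eqP; field.
move=> N i a /andP[uN Nuz] ap au.
rewrite take_cat ltnNge uN /=.
(* The prefix of length [N] is [u], then [m] full copies of [x], then a prefix [y] of [x]. *)
have [m [y [tk [r yr]]]] := take_power x k (N - size u).
have szN : N = (size u + (m * size x + size y))%N.
  rewrite -size_power -size_cat -tk size_takel ?subnKC//.
  by move: Nuz; rewrite size_cat; lia.
have yx : (size y <= size x)%N by rewrite yr size_take; case: ltnP => // /ltnW.
rewrite tk cost_cat uq cost_cat goto_power// cost_power// szN !natrD natrM.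
have cy : - (M * (size y)%:R) <= cost R i q y.
  by have := hM i q y; rewrite ler_norml => /andP[].
have cx : m%:R * ((p ord0 i - e / 2) * (size x)%:R) <= m%:R * cost R i q x.
  rewrite ler_wpM2l//; have := hx i; rewrite /dev ler_norml => /andP[+ _]; lra.
have hL : (M + B) * (size x)%:R <= e * (size u)%:R.
  rewrite mulrC [leRHS]mulrC -ler_pdivrMr// mulrC.
  by apply: (le_trans (ltW (truncnS_gt _))); rewrite ler_nat.
have aB : a <= B by apply: le_trans ap (le_trans (ler_norm _) (pB i)).
have B0 : 0 <= B by rewrite sumr_ge0.
have yx' : (M + B) * (size y)%:R <= (M + B) * (size x)%:R.
  by rewrite ler_wpM2l ?addr_ge0// ler_nat.
have ay : (M + a) * (size y)%:R <= (M + B) * (size y)%:R by rewrite ler_wpM2r// lerD2l.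
have mx : m%:R * (size x)%:R * (a - e) <= m%:R * (size x)%:R * (p ord0 i - e / 2).
  by rewrite ler_wpM2l ?mulr_ge0//; lra.
have ey : 0 <= e * (size y)%:R :> R by rewrite mulr_ge0// ltW.
move: au cy cx hL yx' ay mx ey; move: (cost _ _ _ u) (cost _ _ _ y) (cost _ _ _ x).
move=> cu cy cx *; lra.
Qed.

End Realization.

(** * Infinite words as limits of growing prefixes *)

Section Chain.
Variables (T : Type) (u : nat -> seq T).
Hypothesis u_cat : forall k, exists z, u k.+1 = u k ++ z.
Hypothesis u_size : forall k, (k <= size (u k))%N.

Lemma chain_cat k l : (k <= l)%N -> exists z, u l = u k ++ z.
Proof.
elim: l => [|l IH]; first by rewrite leqn0 => /eqP ->; exists [::]; rewrite cats0.
rewrite leq_eqVlt => /predU1P[->|/IH[z uz]]; first by exists [::]; rewrite cats0.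
by have [z' ->] := u_cat l; exists (z ++ z'); rewrite uz catA.
Qed.

(** Letter [j] is read in [u j.+1], whose length exceeds [j], so the default [x0] is never
    returned. *)
Lemma mkseq_chain x0 k N : (N <= size (u k))%N ->
  mkseq (fun j => nth x0 (u j.+1) j) N = take N (u k).
Proof.
move=> Nk; apply: (@eq_from_nth _ x0) => [|j]; rewrite size_mkseq ?size_takel// => jN.
rewrite nth_mkseq// nth_take//; case: (leqP j.+1 k) => [/chain_cat|/ltnW/chain_cat] [z ->].
  by rewrite nth_cat u_size.
by rewrite nth_cat (leq_trans jN).
Qed.

Lemma chain_bracket N : (size (u 0) <= N)%N ->
  exists k, (size (u k) <= N <= size (u k.+1))%N.
Proof.
move=> u0N; have ex : exists k, (size (u k) <= N)%N by exists 0%N.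
have bd k : (size (u k) <= N -> k <= N)%N by apply: leq_trans.
case: (ex_maxnP ex bd) => k kN kmax; exists k; rewrite kN /=.
by apply: contraT; rewrite -ltnNge => /ltnW/kmax; rewrite ltnn.
Qed.

End Chain.

(** * A word realizing a coordinatewise minimum *)

Section Realize.
Variables (R : realType) (Sigma : finType) (n : nat).
Variable (A : automaton Sigma 'rV[rat]_n).
Hypothesis detA : deterministic A.

(** Phase [k] brings the mean within [harmonic k] of [p k]. Ends of phases reach [v] in each
    coordinate infinitely often, and inside a phase the mean cannot fall much below [v]. *)
Lemma realize_fmin (C : {set state A}) (p : nat -> 'rV[R]_n) (v : 'rV[R]_n) :
  C \in sccs A ->
  (forall k, convex_hull (simple_cycle_values R C) (p k)) ->
  (forall k i, v ord0 i <= p k ord0 i) ->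
  (forall i N, exists2 k, (N <= k)%N & p k ord0 i = v ord0 i) ->
  exists w, forall i, limn_inf (avg R A w i) = v ord0 i.
Proof.
move=> CA pC pv vp.
have [q qC] := scc_nonempty CA.
have pq k := convex_hull_walk_value detA CA qC (pC k).
have har0 k : 0 < harmonic k :> R by rewrite invr_gt0 ltr0n.
have /choice[L hL] k := extend_word (pq k) (har0 k).
have [x0 initq] : exists x, goto (init A) x = q.
  apply: (connect_word detA); have [/(_ q qC)+ _] := sccP CA.
  by rewrite inE.
have [x [x_gt0 xq _]] := pq 0%N 1 ltr01.
have [s0 _] : exists s0 : Sigma, true by case: x x_gt0 {xq} => // s x _; exists s.
(* [Q] is what phase [k] guarantees when it extends [u] to [u']; the length [L k.+1] lets the next
   phase start. *)
pose Q k u u' := [/\ goto (init A) u' = q, (maxn (L k.+1) (size u).+1 <= size u')%N,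
    exists z, u' = u ++ z,
    forall i, `|dev (p k) i (init A) u'| <= harmonic k * (size u')%:R &
    forall N i a, (size u <= N <= size u')%N -> a <= p k ord0 i ->
      a * (size u)%:R <= cost R i (init A) u ->
      (a - harmonic k) * N%:R <= cost R i (init A) (take N u')].
(* For a [u] that violates the invariant the value [[::]] is arbitrary. *)
have /choice[ext hext] : forall ku : nat * seq Sigma, exists u',
    goto (init A) ku.2 = q -> (L ku.1 <= size ku.2)%N -> Q ku.1 ku.2 u'.
  move=> [k u] /=; have [uq|] := eqVneq (goto (init A) u) q; last first.
    by move=> uq; exists [::] => uq'; rewrite uq' eqxx in uq.
  case: (leqP (L k) (size u)) => [Lu|]; last by exists [::].
  have [z [h1 h2 h3 h4]] := hL k u uq Lu (maxn (L k.+1) (size u).+1).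
  by exists (u ++ z) => _ _; split => //; exists z.
pose u0 := x0 ++ power x (L 0).
pose u := fix u k := if k is k'.+1 then ext (k', u k') else u0.
have inv k : goto (init A) (u k) = q /\ (L k <= size (u k))%N.
  elim: k => [|k [uq Lk]].
    rewrite /u /u0; split; first by rewrite goto_cat initq goto_power.
    by rewrite size_cat size_power (leq_trans (leq_pmulr _ x_gt0))// leq_addl.
  have [h1 h2 _ _ _] := hext (k, u k) uq Lk.
  by split => //; move: h2; rewrite geq_max => /andP[].
have uQ k : Q k (u k) (u k.+1) by have [uq Lk] := inv k; exact: (hext (k, u k)).
have u_cat k : exists z, u k.+1 = u k ++ z by have [] := uQ k.
have u_size k : (k <= size (u k))%N.
  elim: k => // k IH; have [_ + _ _ _] := uQ k.
  by rewrite geq_max => /andP[_]; exact: leq_ltn_trans.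
pose w j := nth s0 (u j.+1) j.
have wE N k : (N <= size (u k))%N -> mkseq w N = take N (u k).
  exact: mkseq_chain.
exists w => i; apply: limn_inf_eq; first exact: avg_bounded_fun.
have devP k : `|dev (p k) i (init A) (u k.+1)| <= harmonic k * (size (u k.+1))%:R.
  by have [_ _ _ + _] := uQ k; apply.
have har_small e : 0 < e -> exists k0, forall k, (k0 <= k)%N -> harmonic k <= e :> R.
  move=> e0; exists (Num.truncn e^-1) => k k0k.
  rewrite /harmonic -[leRHS]invrK lef_pV2 ?posrE ?invr_gt0 ?ltr0n//.
  by apply: (le_trans (ltW (truncnS_gt _))); rewrite ler_nat ltnS.
move=> e e0; split; last first.
  (* Upper bound: stop at the end of a late phase whose target agrees with [v] in coordinate [i]. *)
  move=> N; have [k0 hk0] := har_small e e0.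
  have [k Nk pk] := vp i (maxn N k0).
  have uk0 : (0 < size (u k.+1))%N by apply: leq_ltn_trans (u_size k.+1).
  exists (size (u k.+1)).
    by rewrite (leq_trans _ (u_size _))// (leq_trans (leq_maxl N k0))// ltnW.
  rewrite /avg sum_weights_cost (wE _ k.+1)// take_size mulrC.
  rewrite ler_pdivrMr ?ltr0n//.
  have := devP k; rewrite /dev pk ler_norml => /andP[_].
  have : harmonic k * (size (u k.+1))%:R <= e * (size (u k.+1))%:R.
    by rewrite ler_wpM2r// hk0// (leq_trans (leq_maxr N k0)).
  lra.
(* Lower bound: one [e / 2] pays for the error at the end of the previous phase, the other for the
   loss within the current one. *)
have [k0 hk0] := har_small (e / 2) (divr_gt0 e0 (ltr0n _ 2)).
exists (size (u k0.+1)) => N Nk0.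
(* The chain is shifted by [k0.+1] so that the phase containing [N] is late. *)
have u_size' k : (k <= size (u (k0.+1 + k)%N))%N.
  by rewrite (leq_trans _ (u_size _))// leq_addl.
have [|k kN] := chain_bracket u_size' (N := N); first by rewrite addn0.
have N0 : (0 < N)%N by apply: leq_trans Nk0; exact: leq_trans (u_size _).
move: kN; rewrite addnS addSn => kN.
rewrite /avg sum_weights_cost (wE _ (k0 + k).+2); last by case/andP: kN.
rewrite mulrC ler_pdivlMr ?ltr0n//.
have [_ _ _ _ /(_ N i (v ord0 i - harmonic (k0 + k)%N) kN)] := uQ (k0 + k).+1.
have h1 := hk0 _ (leq_addr k k0).
have h2 : harmonic (k0 + k).+1 <= e / 2 by apply: hk0; rewrite leqW// leq_addr.
move=> h; apply: le_trans (h _ _).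
- by rewrite ler_wpM2r//; lra.
- by rewrite (le_trans _ (pv _ _))// gerBl ltW.
have := devP (k0 + k)%N; rewrite /dev ler_norml => /andP[+ _].
have : v ord0 i * (size (u (k0 + k).+1))%:R <= p (k0 + k)%N ord0 i * (size (u (k0 + k).+1))%:R.
  by rewrite ler_wpM2r.
lra.
Qed.

End Realize.

(** * Both inclusions for a deterministic vector-weighted automaton *)

Section Deterministic.
Variables (R : realType) (Sigma : finType) (n : nat).
Variable (A : automaton Sigma 'rV[rat]_n).

Lemma liminf_vectors : deterministic A -> (0 < n)%N ->
  [set \row_i limn_inf (avg R A w i) | w in [set: nat -> Sigma]] =
  \bigcup_(C in [set` sccs A]) F_min (convex_hull (simple_cycle_values R C)).
Proof.
move=> detA n0; apply/seteqP; split => [_ [w _ <-]|v [C /= CA [P [_ _ PC vP]]]].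
  have [C CA [j0 hC]] := run_eventually_scc A w.
  exists C => //.
  have /choice[p hp] i := @limit_point R _ _ A w C j0 i hC.
  exists (range p); split.
  - exact: finite_image.
  - by exists (p (Ordinal n0)), (Ordinal n0).
  - by move=> _ [i _ <-]; have [] := hp i.
  move=> i; rewrite mxE; split.
    by exists (p i); [exists i | have [] := hp i].
  by move=> _ [j _ <-]; have [] := hp j.
have /choice[p hp] i : exists p, P p /\ p ord0 i = v ord0 i.
  by have [[x Px xi] _] := vP i; exists x.
(* Targets cycle through the coordinates, so each coordinate has its minimizing point as target
   infinitely often. *)
pose tgt k : 'I_n := Ordinal (ltn_pmod k n0).
have tgt_io i N : exists2 k, (N <= k)%N & p (tgt k) ord0 i = v ord0 i.
  exists (N * n + i)%N => /=.
    by rewrite (leq_trans (leq_pmulr N n0))// leq_addr.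
  suff -> : tgt (N * n + i)%N = i by exact: (hp i).2.
  by apply: val_inj; rewrite /= modnMDl modn_small.
have [w hw] := realize_fmin detA CA (fun k => PC _ (hp (tgt k)).1)
  (fun k i => (vP i).2 _ (hp (tgt k)).1) tgt_io.
by exists w => //; apply/rowP => i; rewrite mxE.
Qed.

End Deterministic.

(** * Runs of the synchronized product *)

Section SyncProduct.
Variables (Sigma : finType) (n : nat) (A : 'I_n -> automaton Sigma rat).
Hypothesis detA : forall i, deterministic (A i).

Lemma sync_deterministic : deterministic (sync_product A).
Proof.
move=> q s; have [q' hq'] := sync_total q s; exists q'; split => // q'' h.
move: hq' h; rewrite !inE => /forallP hq' /forallP h.
apply/ffunP => i; have [r [_ hr]] := detA (q i) s.
by rewrite -(hr _ (hq' i)) -(hr _ (h i)).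
Qed.

(** The product and its components choose successors independently; determinism forces the choices
    to agree. *)
Lemma sync_component_step (q : state (sync_product A)) s i :
  sync_component (step q s) i = step ((q : sync_state A) i) s.
Proof.
apply: val_inj => /=; congr (_, _, _).
have [r [_ hr]] := detA ((q : sync_state A) i) s.
rewrite -(hr _ (valP (sync_component (step q s) i))).
by rewrite -(hr _ (valP (step ((q : sync_state A) i) s))).
Qed.

Lemma sync_run w j i :
  (run (sync_product A) w j : sync_state A) i = run (A i) w j.
Proof.
elim: j => [|j IH]; first by rewrite /= ffunE.
by rewrite /= -IH -sync_component_step.
Qed.

Lemma sync_weights w j i :
  weights (sync_product A) w j ord0 i = weights (A i) w j.
Proof. by rewrite /weights /= mxE sync_component_step sync_run. Qed.

End SyncProduct.

(** * From expressions to the product *)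

Lemma occurs_deterministic (Sigma : finType) (E : mpexpr Sigma) B :
  occurs B E -> deterministic B.
Proof.
elim: E => [A detA|? IH1 ? IH2|? IH1 ? IH2|? IH1 ? IH2] /=; last 3 first.
- by case=> [/IH1|/IH2].
- by case=> [/IH1|/IH2].
- by case=> [/IH1|/IH2].
by move=> ->.
Qed.

(** This makes [n] positive in the theorem. *)
Lemma occurs_some (Sigma : finType) (E : mpexpr Sigma) : exists B, occurs B E.
Proof.
by elim: E => [A ?|? [B h] ? _|? [B h] ? _|? [B h] ? _]; [exists A | exists B; left..].
Qed.

Theorem theorem1 (R : realType) (Sigma : finType) (E : mpexpr Sigma)
    (n : nat) (A : 'I_n -> automaton Sigma rat) (hE : built_from E A) :
  vector_set R A =
  \bigcup_(C in [set` sccs (sync_product A)])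
    F_min (convex_hull (simple_cycle_values R C)).
Proof.
have detA i : deterministic (A i).
  by apply: (@occurs_deterministic _ E); apply/hE; exists i.
have n0 : (0 < n)%N.
  by have [B /hE[[m mn] _]] := occurs_some E; exact: leq_ltn_trans mn.
rewrite -liminf_vectors//; last exact: sync_deterministic.
apply: eq_imagel => w _; apply/rowP => i; rewrite !mxE /LimInfAvg /avg.
congr limn_inf; apply/funext => N; congr (_ * _).
by apply: eq_bigr => j _; rewrite sync_weights.
Qed.
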